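(* Let $\mathcal{S}$ be the set of EPs and $\mathcal{D}$ the set of EDs of an mE2-VRP instance. Suppose that an EP service plan, with ED waiting times $\tau_i\in[0,\bar\tau_i]$ and node times $t_n^i=\tilde t_0^i+t_{i_0\to n}+\tau_i$ ($i\in\mathcal{D}$, $n\in\mathcal{N}_i$), satisfies the constraints $$t_n^j-t_n^i\ \ge\ M\,(u_{i,j}^{n,s}-1)\qquad \forall s\in\mathcal{S},\ i\in\mathcal{D},\ n\in\mathcal{N}_i\setminus i_0,\ j\in D_n,\ j\ne i,$$ $$t_m^j-t_n^i-t_{n\to m}\ \ge\ M\,(v_{i,j}^{n,m,s}-1)\qquad \forall s\in\mathcal{S},\ i,j\in\mathcal{D},\ i\neq j,\ n\in\mathcal{N}_i\setminus i_0,\ m\in\mathcal{N}_j\setminus j_e,\ n\ne m.$$ Then no EP's trip in the plan contains an illegal subtour. That is, these constraints are valid subtour elimination constraints for the mE2-VRP.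
   Context: Setting. A finite set $\mathcal{D}$ of electric vehicles (EDs) travel on fixed routes in a directed graph whose arcs have positive travel times. The route of ED $i$ is a finite sequence of distinct nodes $\mathcal{N}_i$ starting at $i_0$ and ending at $i_e$. The number $t_{i_0\to n}$ is the travel time of ED $i$ from $i_0$ to $n\in\mathcal{N}_i$ along its route, so it is strictly increasing along the route. For nodes $n\neq m$, $t_{n\to m}>0$ is the average travel time from $n$ to $m$. ED $i$ has estimated arrival time $\tilde t_0^i$ at $i_0$, waits there for a time $\tau_i\in[0,\bar\tau_i]$, and then moves without stopping, so its time at node $n$ is $t_n^i=\tilde t_0^i+t_{i_0\to n}+\tau_i$. $D_n$ is the set of EDs whose routes pass through $n$. $M$ is a sufficiently large constant. A finite set $\mathcal{S}$ of electricity providers (EPs) charge EDs by moving along with them. The trip of EP $s$ is a finite sequence of legs $(i_k,a_k,b_k)$, $k=1,2,\dots$. In leg $k$ the EP joins ED $i_k$ at node $a_k\in\mathcal{N}_{i_k}\setminus (i_k)_e$ and moves together with it along its route to a node $b_k\in\mathcal{N}_{i_k}$ strictly after $a_k$ on that route. Consecutive legs serve different EDs ($i_k\ne i_{k+1}$). - If $b_k=a_{k+1}=n$, the transition from leg $k$ to leg $k+1$ is a local switch at node $n$, and $u_{i_k,i_{k+1}}^{n,s}=1$. - If $b_k=n\ne m=a_{k+1}$, the transition is a distant switch from $n$ to $m$, and $v_{i_k,i_{k+1}}^{n,m,s}=1$. The binary variables $u,v$ are $0$ for switches that are not performed. A subtour is a part of an EP's trip, consisting of consecutive legs $p,p+1,\dots,r$,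 with $r\ge p+2$ and $i_p=i_r$: the EP leaves ED $i_p$, serves other EDs by local or distant switches, and then switches back to the same ED without returning to a depot in between. The subtour is illegal if it makes the EP visit that ED twice at the same node, i.e. if the rejoining node $a_r$ is one of the nodes on the route of ED $i_p$ from $a_p$ to $b_p$ (inclusive). *)

(* Defs.v *)
From mathcomp Require Import all_boot all_order all_algebra.

Set Implicit Arguments.
Unset Strict Implicit.
Unset Printing Implicit Defensive.

Import Order.TTheory GRing.Theory Num.Theory.
Local Open Scope ring_scope.

(* V: nodes of the road network; D: electric vehicles (EDs). The big constant M
   of the constraints is not part of the data. *)
Record instance (R : realFieldType) (V : eqType) (D : finType) := Instance {
  arc : rel V;
  arc_time : V -> V -> R;
  arc_time_gt0 : forall n m, arc n m -> 0 < arc_time n m;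
  avg_time : V -> V -> R;
  avg_time_gt0 : forall n m, n != m -> 0 < avg_time n m;
  orig : D -> V;
  next_nodes : D -> seq V;
  route_path : forall i, path arc (orig i) (next_nodes i);
  route_uniq : forall i, uniq (orig i :: next_nodes i);
  est_arrival : D -> R;
  max_wait : D -> R
}.

Section Instance.
Variables (R : realFieldType) (V : eqType) (D : finType) (I : instance R V D).

Definition route (i : D) : seq V := orig I i :: next_nodes I i.

Definition dest (i : D) : V := last (orig I i) (next_nodes I i).

Definition EDs_through (n : V) : {set D} := [set i | n \in route i].

(* Sum of the arc times on the route of i before n; meaningful for
   n \in route i only. *)
Definition travel_time (i : D) (n : V) : R :=
  \sum_(k < index n (route i))
    arc_time I (nth (orig I i) (route i) k) (nth (orig I i) (route i) k.+1).

Definition node_time (tau : D -> R) (i : D) (n : V) : R :=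
  est_arrival I i + travel_time i n + tau i.

Definition route_segment (i : D) (a b : V) : seq V :=
  [seq n <- route i | (index a (route i) <= index n (route i) <= index b (route i))%N].

End Instance.

Record leg (V : eqType) (D : finType) := Leg {
  leg_ED : D;
  leg_join : V;
  leg_leave : V
}.

Section Trip.
Variables (R : realFieldType) (V : eqType) (D : finType) (I : instance R V D).
Implicit Types (l : leg V D) (trip : seq (leg V D)).

Definition valid_leg l : Prop :=
  [/\ leg_join l \in route I (leg_ED l),
      leg_join l != dest I (leg_ED l),
      leg_leave l \in route I (leg_ED l)
    & (index (leg_join l) (route I (leg_ED l))
       < index (leg_leave l) (route I (leg_ED l)))%N].

Definition consecutive trip l l' : Prop :=
  exists k : nat, onth trip k = Some l /\ onth trip k.+1 = Some l'.

Definition valid_trip trip : Prop :=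
  (forall k l, onth trip k = Some l -> valid_leg l) /\
  (forall l l', consecutive trip l l' -> leg_ED l != leg_ED l').

Definition local_switch trip (i j : D) (n : V) : Prop :=
  exists l l', [/\ consecutive trip l l', leg_ED l = i, leg_ED l' = j,
                   leg_leave l = n & leg_join l' = n].

Definition distant_switch trip (i j : D) (n m : V) : Prop :=
  n <> m /\
  exists l l', [/\ consecutive trip l l', leg_ED l = i, leg_ED l' = j,
                   leg_leave l = n & leg_join l' = m].

Definition subtour trip (p r : nat) (lp lr : leg V D) : Prop :=
  [/\ (p + 2 <= r)%N, onth trip p = Some lp, onth trip r = Some lr
    & leg_ED lp = leg_ED lr].

Definition illegal_subtour trip (p r : nat) : Prop :=
  exists lp lr,
    subtour trip p r lp lr /\
    leg_join lr \in route_segment I (leg_ED lp) (leg_join lp) (leg_leave lp).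

End Trip.

(* S: electricity providers (EPs). A trip has no depot visit between its legs. *)
Record service_plan (R : realFieldType) (V : eqType) (D : finType)
    (I : instance R V D) (S : finType) := ServicePlan {
  trip : S -> seq (leg V D);
  trip_valid : forall s, valid_trip I (trip s);
  wait : D -> R;
  wait_bounds : forall i, 0 <= wait i <= max_wait I i;
  u : S -> D -> D -> V -> bool;
  uP : forall s i j n, u s i j n <-> local_switch (trip s) i j n;
  v : S -> D -> D -> V -> V -> bool;
  vP : forall s i j n m, v s i j n m <-> distant_switch (trip s) i j n m
}.

(* Main.v *)
(* The EP never goes back in time: within a leg the time strictly increases, and
   a performed switch makes its big-M constraint say that the next leg is joined
   no earlier than the current one is left. A subtour contains a whole leg
   between leaving an ED and rejoining it, so the rejoining time is strictly
   later than the leaving time, hence than the time of that ED at every node of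
   the segment along which it was first served. *)
Require Import Defs.
From mathcomp Require Import all_boot all_order all_algebra.

Set Implicit Arguments.
Unset Strict Implicit.
Unset Printing Implicit Defensive.

Import Order.TTheory GRing.Theory Num.Theory.
Local Open Scope ring_scope.

Lemma onth_ltn (T : Type) (s : seq T) (i j : nat) (y : T) :
  (i < j)%N -> onth s j = Some y -> exists x, onth s i = Some x.
Proof.
move=> lt_ij sj; case si: (onth s i) => [x|]; first by exists x.
have: onth s i by rewrite onthTE (ltn_trans lt_ij) // -onthTE sj.
by rewrite si.
Qed.

Section TravelTime.
Variables (R : realFieldType) (V : eqType) (D : finType) (I : instance R V D).

(** The difference is the sum of the arc times between the indices of [a] and [b], a nonempty range
    of positive terms. *)
Lemma travel_time_lt (i : D) (a b : V) :
  b \in route I i -> (index a (route I i) < index b (route I i))%N ->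
  travel_time I i a < travel_time I i b.
Proof.
move=> b_route lt_ab; rewrite /travel_time.
set w := fun k => arc_time I (nth (orig I i) (route I i) k)
                             (nth (orig I i) (route I i) k.+1).
rewrite -!(big_mkord xpredT w).
rewrite (big_cat_nat (n := index a (route I i))
  (p := index b (route I i))) //=; last exact: ltnW.
rewrite ltrDl.
have w_gt0 k : (k < index b (route I i))%N -> 0 < w k.
  move=> lt_kb; apply/arc_time_gt0/(pathP _ (route_path I i)).
  (* Arc [k] ends at the node of index [k.+1], which is at most the index of [b] and so still on the
     route. *)
  by rewrite -ltnS; apply: leq_ltn_trans lt_kb _; rewrite index_mem.
(* The first arc out of [a] gives strictness; the others only need to be nonnegative. *)
rewrite big_ltn //; apply: ltr_wpDr; last exact: w_gt0.
by rewrite big_nat; apply: sumr_ge0 => k /andP[_ lt_kb]; apply/ltW/w_gt0.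
Qed.

Lemma node_time_lt (tau : D -> R) (i : D) (a b : V) :
  b \in route I i -> (index a (route I i) < index b (route I i))%N ->
  node_time I tau i a < node_time I tau i b.
Proof. by move=> b_route lt_ab; rewrite ltrD2r ltrD2l travel_time_lt. Qed.

Lemma node_time_le (tau : D -> R) (i : D) (a b : V) :
  a \in route I i -> b \in route I i ->
  (index a (route I i) <= index b (route I i))%N ->
  node_time I tau i a <= node_time I tau i b.
Proof.
move=> a_route b_route; rewrite leq_eqVlt => /predU1P[/index_inj -> //|lt_ab].
exact/ltW/node_time_lt.
Qed.

Definition join_time (tau : D -> R) (l : leg V D) : R :=
  node_time I tau (leg_ED l) (leg_join l).

Definition leave_time (tau : D -> R) (l : leg V D) : R :=
  node_time I tau (leg_ED l) (leg_leave l).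

Lemma join_lt_leave_time (tau : D -> R) (l : leg V D) :
  valid_leg I l -> join_time tau l < leave_time tau l.
Proof. by case=> _ _ leave_route lt_jl; apply: node_time_lt. Qed.

(** The switch constraints are stated away from the origin; this makes them applicable where a leg
    ends. The origin has index 0, whereas the leaving index exceeds the joining one. *)
Lemma leave_neq_orig (l : leg V D) :
  valid_leg I l -> leg_leave l != orig I (leg_ED l).
Proof.
case=> _ _ _ lt_jl; apply: contraTneq lt_jl => ->.
by rewrite /route /= eqxx.
Qed.

(** Induction on [q]: from the joining of leg [q], one passes to its leaving and then through one
    switch to the joining of leg [q.+1]. *)
Lemma leave_le_later_join (tau : D -> R) (trip : seq (leg V D)) :
  valid_trip I trip ->
  (forall l l', consecutive trip l l' -> leave_time tau l <= join_time tau l') ->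
  forall p q lp lq, (p < q)%N -> onth trip p = Some lp ->
    onth trip q = Some lq -> leave_time tau lp <= join_time tau lq.
Proof.
move=> [legP _] switch_le p q lp lq lt_pq trip_p; elim: q lt_pq lq => // q IHq.
rewrite ltnS leq_eqVlt => /predU1P[<- lq trip_q|lt_pq lq trip_q].
  by apply: switch_le; exists p.
have [l trip_q'] := onth_ltn (ltnSn q) trip_q.
apply: le_trans (IHq lt_pq _ trip_q') _.
apply: le_trans (ltW (join_lt_leave_time tau (legP _ _ trip_q'))) _.
by apply: switch_le; exists q.
Qed.

End TravelTime.

(** The switch is local or distant according to whether the two nodes agree, so [u] or [v] is 1 and
    the bound [M * (1 - 1)] is 0. In the distant case a positive travel time is to spare. *)
Lemma leave_le_next_join (R : realFieldType) (V : eqType) (S D : finType)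
    (I : instance R V D) (plan : service_plan I S) (M : R)
    (hu : forall (s : S) (i : D) (n : V) (j : D),
        n \in route I i -> n != orig I i -> j \in EDs_through I n -> j != i ->
        node_time I (wait plan) j n - node_time I (wait plan) i n
          >= M * ((u plan s i j n)%:R - 1))
    (hv : forall (s : S) (i j : D) (n m : V),
        i != j -> n \in route I i -> n != orig I i ->
        m \in route I j -> m != dest I j -> n != m ->
        node_time I (wait plan) j m - node_time I (wait plan) i n
          - avg_time I n m >= M * ((v plan s i j n m)%:R - 1))
    (s : S) (l l' : leg V D) :
  consecutive (trip plan s) l l' ->
  leave_time I (wait plan) l <= join_time I (wait plan) l'.
Proof.
move=> ll'; have [legP switchP] := trip_valid plan s.
have neq_ll' := switchP _ _ ll'.
have [k [/legP lP /legP l'P]] := ll'.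
have leave_orig := leave_neq_orig lP.
have [_ _ leave_route _] := lP; have [join_route join_dest _ _] := l'P.
rewrite /leave_time /join_time -subr_ge0.
have [eq_n|neq_n] := eqVneq (leg_leave l) (leg_join l').
  have uT : u plan s (leg_ED l) (leg_ED l') (leg_leave l).
    by apply/uP; exists l, l'; split.
  have := @hu s (leg_ED l) (leg_leave l) (leg_ED l') leave_route leave_orig.
  (* The shared node is on the route of the next ED because that ED is joined there. *)
  rewrite inE eq_n join_route eq_sym neq_ll' -eq_n uT subrr mulr0.
  by apply.
have vT : v plan s (leg_ED l) (leg_ED l') (leg_leave l) (leg_join l').
  by apply/vP; split; [exact/eqP | exists l, l'; split].
have := hv s _ _ _ _ neq_ll' leave_route leave_orig join_route join_dest neq_n.
rewrite vT subrr mulr0 [in X in X -> _]subr_ge0; apply: le_trans.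
exact/ltW/avg_time_gt0.
Qed.

Theorem theorem1 (R : realFieldType) (V : eqType) (S D : finType)
    (I : instance R V D) (plan : service_plan I S) (M : R)
    (hu : forall (s : S) (i : D) (n : V) (j : D),
        n \in route I i -> n != orig I i -> j \in EDs_through I n -> j != i ->
        node_time I (wait plan) j n - node_time I (wait plan) i n
          >= M * ((u plan s i j n)%:R - 1))
    (hv : forall (s : S) (i j : D) (n m : V),
        i != j -> n \in route I i -> n != orig I i ->
        m \in route I j -> m != dest I j -> n != m ->
        node_time I (wait plan) j m - node_time I (wait plan) i n
          - avg_time I n m >= M * ((v plan s i j n m)%:R - 1)) :
  forall (s : S) (p r : nat), ~ illegal_subtour I (trip plan s) p r.
Proof.
move=> s p r [lp [lr [[le_pr trip_p trip_r eq_ED]]]].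
rewrite mem_filter => /andP[/andP[_ le_join] join_route].
have [legP _] := trip_valid plan s.
have switch_le := leave_le_next_join hu hv (s := s).
(* The rejoining leg now has index [r.+1], and [p + 2 <= r.+1] becomes [p < r]: leg [r] lies
   strictly between the two visits and supplies the strict inequality. *)
case: r le_pr trip_r => [|r]; rewrite ?addn2 // ltnS => lt_pr trip_r.
have [l trip_r'] := onth_ltn (ltnSn r) trip_r.
have lt_leave_join : leave_time I (wait plan) lp < join_time I (wait plan) lr.
  apply: le_lt_trans
    (leave_le_later_join (trip_valid plan s) switch_le lt_pr trip_p trip_r') _.
  apply: lt_le_trans (join_lt_leave_time _ (legP _ _ trip_r')) _.
  by apply: switch_le; exists r.
have [_ _ leave_route _] := legP _ _ trip_p.
(* Both times belong to the same ED, with a single waiting time, so they are ordered as the nodes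
   are on its route; the rejoining node is not past the leaving node. *)
move: lt_leave_join; rewrite ltNge /join_time -eq_ED.
by rewrite (node_time_le _ join_route leave_route le_join).
Qed.
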